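(* Let $W\in\mathbb{R}^{N\times N}$ be symmetric, $\mu$ a compactly supported probability measure on $\mathbb{R}$, and $f_t:\mathbb{R}\to\mathbb{R}$, $t\ge1$, continuous functions. Let $(r_t)_{t\ge1},(u_t)_{t\ge1}$ be generated by the RI-AMP-MP algorithm and set $\bar u_1:=u_1$, $\bar u_t:=u_t-\sum_{i=1}^{t-1}\langle\partial_iu_t\rangle r_i$ for $t>1$. Then the following hold for all $t\ge1$. (1) For any fixed lower triangular de-biasing matrix $E_t\in\mathbb{R}^{t\times t}$, one has $r_s=\sum_{j=1}^s\hat J_{s,j}(W)\bar u_j$ for $1\le s\le t$, where the functions $\hat J_{s,j}:\mathbb{R}\to\mathbb{R}$, collected in the lower triangular matrix $\hat J_t(\lambda)=(\hat J_{s,j}(\lambda))_{1\le s,j\le t}$ (with $\hat J_{s,j}:=0$ for $j>s$), are given by $$\hat J_t(\lambda)=\left(I_t-\mathrm{diag}\{f_1(\lambda),\dots,f_t(\lambda)\}\hat\Phi_t+E_t\hat\Phi_t\right)^{-1}\left(\mathrm{diag}\{f_1(\lambda),\dots,f_t(\lambda)\}-E_t\right),\qquad\forall\lambda\in\mathbb{R}.$$ (2) For any strictly lower triangular $\hat\Phi_t\in\mathbb{R}^{t\times t}$, the equation $$\mathbb{E}\left[\hat J_t(\Lambda)\right]=0_{t\times t}$$ has a unique solution in the lower triangular matrix $E_t$, where the expectation is taken with respect to $\Lambda\sim\mu$ independent of $\hat\Phi_t$ (i.e. with $\hat\Phi_t$ held fixed).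
   Context: RI-AMP-MP algorithm: starting from $u_1\in\mathbb{R}^N$, for $t\ge1$, $$r_t=f_t(W)u_t-(e_{t,1}u_1+\cdots+e_{t,t}u_t),\qquad u_{t+1}=\eta_{t+1}(r_1,\dots,r_t),$$ where $\eta_{t+1}:\mathbb{R}^t\to\mathbb{R}$ (with partial derivatives) acts separately on the $N$ rows of $(r_1,\dots,r_t)$, and $E_t=(e_{s,i})_{1\le i\le s\le t}$ is the lower triangular matrix of de-biasing coefficients. For $f:\mathbb{R}\to\mathbb{R}$ and an eigendecomposition $W=O\,\mathrm{diag}(\lambda_1,\dots,\lambda_N)O^{\mathsf T}$, $f(W):=O\,\mathrm{diag}(f(\lambda_1),\dots,f(\lambda_N))O^{\mathsf T}$. Write $\langle\partial_iu_j\rangle:=\frac1N\sum_{n=1}^N\partial_i\eta_j(r_1[n],\dots,r_{j-1}[n])$; in (1), $\hat\Phi_t\in\mathbb{R}^{t\times t}$ is the strictly lower triangular matrix with $(j,i)$ entry $\langle\partial_iu_j\rangle$ for $1\le i<j\le t$. *)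

(* Defs.v *)
From mathcomp Require Import all_boot all_order all_algebra.
From mathcomp Require Import all_classical all_reals all_analysis.

Set Implicit Arguments.
Unset Strict Implicit.
Unset Printing Implicit Defensive.

Import Order.TTheory GRing.Theory Num.Theory.
Import numFieldNormedType.Exports.

Local Open Scope classical_set_scope.
Local Open Scope ring_scope.

(* Time indices s, t, i, j are natural numbers starting at 1; values at time 0
   are never used. Row or column k : 'I_t of a t x t matrix is time k.+1. *)

Definition eigendecomposition (R : realType) (N : nat)
    (W O : 'M[R]_N) (lam : 'rV[R]_N) : Prop :=
  [/\ O^T *m O = 1%:M, O *m O^T = 1%:M & W = O *m diag_mx lam *m O^T].

Definition mxfun (R : realType) (N : nat) (O : 'M[R]_N) (lam : 'rV[R]_N)
    (g : R -> R) : 'M[R]_N :=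
  O *m diag_mx (map_mx g lam) *m O^T.

(* (r_1[n], ..., r_k[n]) *)
Definition history (R : realType) (N : nat) (r : nat -> 'cV[R]_N) (k : nat)
    (n : 'I_N) : 'rV[R]_k :=
  \row_(i < k) r i.+1 n 0.

(* The denoiser eta_j is a function of j - 1 real variables. *)
Definition ri_amp_mp (R : realType) (N : nat) (O : 'M[R]_N) (lam : 'rV[R]_N)
    (f : nat -> R -> R) (eta : forall j : nat, 'rV[R]_j.-1 -> R)
    (e : nat -> nat -> R) (r u : nat -> 'cV[R]_N) : Prop :=
  forall t : nat, (0 < t)%N ->
    r t = mxfun O lam (f t) *m u t - \sum_(1 <= i < t.+1) e t i *: u i /\
    u t.+1 = \col_n eta t.+1 (history r t n).

(* The i-th standard basis vector, for 1 <= i <= k. *)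
Definition evec (R : realType) (k i : nat) : 'rV[R]_k :=
  \row_(l < k) (l.+1 == i)%:R.

Definition partial (R : realType) (k i : nat) (g : 'rV[R]_k -> R)
    (x : 'rV[R]_k) : R :=
  'D_(evec R k i) g x.

Definition has_partials (R : realType) (k : nat) (g : 'rV[R]_k -> R) : Prop :=
  forall (i : nat) (x : 'rV[R]_k), (1 <= i <= k)%N ->
    derivable g x (evec R k i).

(* <d_i u_j> *)
Definition avg_partial (R : realType) (N : nat)
    (eta : forall j : nat, 'rV[R]_j.-1 -> R) (r : nat -> 'cV[R]_N)
    (i j : nat) : R :=
  N%:R^-1 * \sum_(n < N) partial i (eta j) (history r j.-1 n).

(* For t = 1 the sum is empty. *)
Definition ubar (R : realType) (N : nat)
    (eta : forall j : nat, 'rV[R]_j.-1 -> R) (r u : nat -> 'cV[R]_N)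
    (t : nat) : 'cV[R]_N :=
  u t - \sum_(1 <= i < t) avg_partial eta r i t *: r i.

(* is_trig_mx is the library's predicate for lower triangular matrices. *)
Definition strictly_lower (R : realType) (t : nat) (A : 'M[R]_t) : Prop :=
  forall j i : 'I_t, (j <= i)%N -> A j i = 0.

Definition Phihat (R : realType) (N : nat)
    (eta : forall j : nat, 'rV[R]_j.-1 -> R) (r : nat -> 'cV[R]_N)
    (t : nat) : 'M[R]_t :=
  \matrix_(j < t, i < t)
    if (i < j)%N then avg_partial eta r i.+1 j.+1 else 0.

Definition fdiag (R : realType) (f : nat -> R -> R) (t : nat) (x : R) :
    'M[R]_t :=
  diag_mx (\row_(s < t) f s.+1 x).

Definition Jden (R : realType) (f : nat -> R -> R) (t : nat)
    (Phi E : 'M[R]_t) (x : R) : 'M[R]_t :=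
  1%:M - fdiag f t x *m Phi + E *m Phi.

(* invmx is the inverse only on unitmx. *)
Definition Jhat (R : realType) (f : nat -> R -> R) (t : nat)
    (Phi E : 'M[R]_t) (x : R) : 'M[R]_t :=
  invmx (Jden f Phi E x) *m (fdiag f t x - E).

Definition msupport (R : realType) (mu : probability (measurableTypeR R) R) :
    set R :=
  [set x | forall U : set R, open U -> U x -> (0 < mu U)%E].

Definition compactly_supported (R : realType)
    (mu : probability (measurableTypeR R) R) : Prop :=
  compact (msupport mu).

(* Main.v *)
Require Import Defs.
From mathcomp Require Import all_boot all_order all_algebra.
From mathcomp Require Import all_classical all_reals all_analysis.

Set Implicit Arguments.
Unset Strict Implicit.
Unset Printing Implicit Defensive.

Import Order.TTheory GRing.Theory Num.Theory.
Import numFieldNormedType.Exports.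

Local Open Scope classical_set_scope.
Local Open Scope ring_scope.

(* (1) In the eigenbasis of W the recursion decouples: in each coordinate, with
   eigenvalue x, it is the linear system r = (F - E) u, u = ubar + Phi r with
   F = diag (f_1 x, ..., f_t x), hence (1 - (F - E) Phi) r = (F - E) ubar.  The
   matrix on the left is unitriangular.

   (2) J = (F - E) U with U = 1 + Phi J, and row s of U only involves the rows
   of J, hence of E, before s.  Once the rows of J before s have mean zero,
   E[U_kj] is 1 if k = j and 0 otherwise, for k <= s, so E[J_sj] = 0 reads
   E_sj = E[f_s U_sj], whose right-hand side depends only on the rows of E
   before s: the rows of E are determined one after the other.  All expectations
   are finite, since J is continuous in x and mu is carried by a compact set. *)

(** * Triangular structure and row recursion of [Jhat] *)

Lemma trig_mul_strictly_lower (R : realType) (t : nat) (A B : 'M[R]_t) :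
  is_trig_mx A -> strictly_lower B -> strictly_lower (A *m B).
Proof.
move=> /is_trig_mxP trigA lowB j i leji; rewrite mxE big1 // => k _.
case: (leqP k i) => [leki|ltik]; first by rewrite lowB ?mulr0.
by rewrite trigA ?mul0r // (leq_ltn_trans leji).
Qed.

Lemma fdiag_sub_trig (R : realType) (f : nat -> R -> R) (t : nat)
    (E : 'M[R]_t) (x : R) : is_trig_mx E -> is_trig_mx (fdiag f t x - E).
Proof.
move=> /is_trig_mxP trigE; apply/is_trig_mxP => i j ltij.
by rewrite !mxE trigE // -val_eqE /= ltn_eqF // mulr0n subr0.
Qed.

Lemma JdenE (R : realType) (f : nat -> R -> R) (t : nat) (Phi E : 'M[R]_t)
    (x : R) : Jden f Phi E x = 1%:M - (fdiag f t x - E) *m Phi.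
Proof. by rewrite /Jden mulmxBl opprB addrA addrAC. Qed.

Lemma Jden_unit (R : realType) (f : nat -> R -> R) (t : nat)
    (Phi E : 'M[R]_t) (x : R) :
  strictly_lower Phi -> is_trig_mx E -> Jden f Phi E x \in unitmx.
Proof.
move=> lowPhi trigE.
have low := trig_mul_strictly_lower (fdiag_sub_trig f x trigE) lowPhi.
rewrite JdenE unitmxE det_trig.
  by rewrite big1 ?unitr1 // => i _; rewrite 2!mxE eqxx mxE low // subr0.
apply/is_trig_mxP => i j ltij.
by rewrite 2!mxE [in X in _ + X]mxE low 1?ltnW // subr0 -val_eqE /= ltn_eqF.
Qed.

(* Row k holds the coefficients of u_k on ubar_1, ..., ubar_t. *)
Definition Uhat (R : realType) (f : nat -> R -> R) (t : nat)
    (Phi E : 'M[R]_t) (x : R) : 'M[R]_t :=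
  1%:M + Phi *m Jhat f Phi E x.

(** Clearing the inverse gives (1 - (F - E) Phi) J = F - E; moving the Phi term to the right avoids
    any inverse in later arguments. *)
Lemma Jhat_rec (R : realType) (f : nat -> R -> R) (t : nat)
    (Phi E : 'M[R]_t) (x : R) :
  strictly_lower Phi -> is_trig_mx E ->
  Jhat f Phi E x = (fdiag f t x - E) *m Uhat f Phi E x.
Proof.
move=> lowPhi trigE; have := mulKVmx (Jden_unit f x lowPhi trigE)
  (fdiag f t x - E).
rewrite -/(Jhat f Phi E x) JdenE mulmxBl mul1mx mulmxDr mulmx1 -mulmxA.
by move/eqP; rewrite subr_eq => /eqP.
Qed.

Lemma Uhat_entry (R : realType) (f : nat -> R -> R) (t : nat)
    (Phi E : 'M[R]_t) (x : R) (k j : 'I_t) :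
  strictly_lower Phi ->
  Uhat f Phi E x k j =
    (k == j)%:R + \sum_(l < t | (l < k)%N) Phi k l * Jhat f Phi E x l j.
Proof.
move=> lowPhi; rewrite 3!mxE; congr (_ + _).
rewrite [RHS]big_mkcond; apply: eq_bigr => l _.
by case: ltnP => // lekl; rewrite lowPhi ?mul0r.
Qed.

Lemma Jhat_entry (R : realType) (f : nat -> R -> R) (t : nat)
    (Phi E : 'M[R]_t) (x : R) (s j : 'I_t) :
  strictly_lower Phi -> is_trig_mx E ->
  Jhat f Phi E x s j = f s.+1 x * Uhat f Phi E x s j -
    \sum_(k < t | (k <= s)%N) E s k * Uhat f Phi E x k j.
Proof.
move=> lowPhi trigE; rewrite {1}Jhat_rec // mulmxBl mul_diag_mx 2!mxE.
rewrite [X in X * _]mxE [X in _ + X]mxE; congr (_ - _).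
rewrite mxE [RHS]big_mkcond; apply: eq_bigr => k _.
by case: leqP => // ltsk; rewrite (is_trig_mxP trigE) ?mul0r.
Qed.

(** Strong induction on the row s: for k <= s < j the Kronecker term of U_kj is zero, and its other
    terms involve only rows of J before s. *)
Lemma Jhat_trig (R : realType) (f : nat -> R -> R) (t : nat)
    (Phi E : 'M[R]_t) (x : R) :
  strictly_lower Phi -> is_trig_mx E -> is_trig_mx (Jhat f Phi E x).
Proof.
move=> lowPhi trigE; apply/is_trig_mxP => s j.
have [m] := ubnP s; elim: m s => // m IHm s; rewrite ltnS => lesm ltsj.
have U0 (k : 'I_t) : (k <= s)%N -> Uhat f Phi E x k j = 0.
  move=> leks; rewrite Uhat_entry // -val_eqE /=.
  rewrite (ltn_eqF (leq_ltn_trans leks ltsj)) add0r big1 // => l ltlk.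
  have ltls := leq_trans ltlk leks.
  by rewrite (IHm l (leq_trans ltls lesm) (ltn_trans ltls ltsj)) mulr0.
rewrite Jhat_entry // U0 // mulr0 big1 ?subrr // => k leks.
by rewrite U0 ?mulr0.
Qed.

(** With A = F - E, this is the push-through identity A (1 - Phi A) = (1 - A Phi) A applied to u. *)
Lemma Jhat_solve (R : realType) (f : nat -> R -> R) (t : nat)
    (Phi E : 'M[R]_t) (x : R) (r u : 'cV[R]_t) :
  strictly_lower Phi -> is_trig_mx E ->
  r = (fdiag f t x - E) *m u -> r = Jhat f Phi E x *m (u - Phi *m r).
Proof.
move=> lowPhi trigE ->; rewrite /Jhat -mulmxA.
set A := fdiag f t x - E.
apply: (canRL (mulKmx (Jden_unit f x lowPhi trigE))).
by rewrite JdenE mulmxBl mul1mx mulmxBr !mulmxA.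
Qed.

(** * Decoupling of the iterates in the eigenbasis of W *)

Lemma mxfun_eigenbasis (R : realType) (N : nat) (O : 'M[R]_N) (lam : 'rV[R]_N)
    (g : R -> R) (v : 'cV[R]_N) (n : 'I_N) :
  O^T *m O = 1%:M ->
  (O^T *m (mxfun O lam g *m v)) n 0 = g (lam 0 n) * (O^T *m v) n 0.
Proof.
move=> OO; rewrite /mxfun !mulmxA OO mul1mx -mulmxA mul_diag_mx mxE.
by rewrite mxE.
Qed.

Lemma Phihat_strictly_lower (R : realType) (N : nat)
    (eta : forall j : nat, 'rV[R]_j.-1 -> R) (r : nat -> 'cV[R]_N) (t : nat) :
  strictly_lower (Phihat eta r t).
Proof. by move=> j i leji; rewrite mxE ltnNge leji. Qed.

Lemma sum_from1_ord (V : zmodType) (t m : nat) (F : nat -> V) :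
  (m <= t)%N ->
  \sum_(1 <= i < m.+1) F i = \sum_(i < t | (i < m)%N) F i.+1.
Proof.
by move=> lemt; rewrite big_add1 big_mkord (big_ord_widen t (F \o succn)).
Qed.

Lemma ri_amp_mp_rE (R : realType) (N : nat) (O : 'M[R]_N) (lam : 'rV[R]_N)
    (f : nat -> R -> R) (eta : forall j : nat, 'rV[R]_j.-1 -> R)
    (e : nat -> nat -> R) (r u : nat -> 'cV[R]_N) (t : nat) (E : 'M[R]_t) :
  O^T *m O = 1%:M ->
  ri_amp_mp O lam f eta e r u -> is_trig_mx E ->
  (forall s i : 'I_t, (i <= s)%N -> E s i = e s.+1 i.+1) ->
  forall s : 'I_t,
    r s.+1 = \sum_(j < t | (j <= s)%N)
      mxfun O lam (fun x => Jhat f (Phihat eta r t) E x s j)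
        *m ubar eta r u j.+1.
Proof.
move=> OTO amp trigE eE s; set Phi := Phihat eta r t.
have lowPhi : strictly_lower Phi := @Phihat_strictly_lower _ _ eta r t.
(* Multiplication by O^T is injective, so it suffices to compare eigencoordinates, one eigenvalue x
   at a time. *)
have [uOT _] := mulmx1_unit OTO; apply: (can_inj (mulKmx uOT)).
apply/colP => n; set x := lam 0 n.
(* The n-th eigencoordinates of the vectors at times 1 to t, gathered in one column; entry k is time
   k.+1. *)
pose coord (v : nat -> 'cV[R]_N) : 'cV[R]_t :=
  \col_k (O^T *m v k.+1) n 0.
have coordE v k : coord v k 0 = (O^T *m v k.+1) n 0 by rewrite mxE.
have rE : coord r = (fdiag f t x - E) *m coord u.
  apply/colP => k; rewrite mulmxBl mul_diag_mx coordE [RHS]mxE.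
  rewrite [X in _ = X + _]mxE [X in _ = X * _ + _]mxE coordE.
  rewrite [X in _ = _ + X]mxE [X in - X]mxE.
  have [-> _] := amp k.+1 isT.
  rewrite (sum_from1_ord _ (ltn_ord k)) mulmxBr mulmx_sumr.
  rewrite mxE mxfun_eigenbasis //; congr (_ + _).
  rewrite mxE summxE; congr (- _).
  rewrite [LHS]big_mkcond; apply: eq_bigr => i _; rewrite ltnS.
  case: leqP => [leik|ltki]; last by rewrite (is_trig_mxP trigE) ?mul0r.
  by rewrite -scalemxAr mxE eE // coordE.
have ubarE : coord (ubar eta r u) = coord u - Phi *m coord r.
  apply/colP => k; rewrite coordE [RHS]mxE coordE [X in _ = _ + X]mxE.
  rewrite [X in - X]mxE /ubar.
  rewrite (sum_from1_ord _ (ltnW (ltn_ord k))) mulmxBr mulmx_sumr mxE.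
  congr (_ + _); rewrite mxE summxE; congr (- _).
  rewrite [LHS]big_mkcond; apply: eq_bigr => i _; rewrite [Phi k i]mxE.
  case: ifP => _; last by rewrite mul0r.
  by rewrite -scalemxAr mxE coordE.
have /colP/(_ s) := Jhat_solve lowPhi trigE rE.
rewrite -ubarE coordE => ->; rewrite mxE mulmx_sumr summxE.
rewrite [RHS]big_mkcond; apply: eq_bigr => j _.
case: leqP => [lejs|ltsj]; last first.
  by rewrite (is_trig_mxP (Jhat_trig _ _ lowPhi trigE)) ?mul0r.
by rewrite mxfun_eigenbasis // coordE.
Qed.

(** * Compact support and integrability *)

Lemma msupportC_negligible (R : realType)
    (mu : probability (measurableTypeR R) R) :
  mu.-negligible (~` msupport mu).
Proof.
(* Second countability: the null balls with rational centre and radius cover the complement of the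
   support, and there are countably many. A code of no pair gives the empty set. *)
pose ratball (k : nat) : set R :=
  if unpickle k : option (rat * rat) is Some (c, q)
  then ball (ratr c : R) (ratr q) else set0.
have ratball_open k : open (ratball k).
  rewrite /ratball; case: (unpickle k) => [[c q]|]; last exact: open0.
  exact: ball_open.
pose null (k : nat) : set R :=
  if mu (ratball k) == 0%E then ratball k else set0.
have cover : ~` msupport mu `<=` \bigcup_k null k.
  move=> x /existsNP[U /not_implyP[openU /not_implyP[Ux /negP]]].
  rewrite -leNgt measure_le0 => /eqP muU0.
  have [c [q [xB BU]]] := open_subball_rat openU (mem_set Ux).
  exists (pickle (c, q)) => //; rewrite /null /ratball pickleK ifT.
    exact: set_mem.
  rewrite -measure_le0 -muU0 le_measure ?inE //.
  - by apply: measurable_realfun.open_measurable; exact: ball_open.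
  - exact: measurable_realfun.open_measurable.
apply: (@negligibleS _ _ _ mu _ _ cover); apply: negligible_bigcup => k.
exists (null k); split => //; rewrite /null; case: eqP => // _.
exact: measurable_realfun.open_measurable.
Qed.

(** g may be unbounded on the line, but the complement of the support is negligible and g is bounded
    on the compact support. *)
Lemma compactly_supported_integrable (R : realType)
    (mu : probability (measurableTypeR R) R) (g : R -> R) :
  compactly_supported mu -> continuous g ->
  mu.-integrable setT (EFin \o g : measurableTypeR R -> \bar R).
Proof.
move=> cptmu cg.
have mg := measurable_realfun.continuous_measurable_fun cg.
have mS := measurable_realfun.compact_measurable cptmu.
have mSC := measurableC mS.
apply/(@negligible_integrable _ _ _ mu _ _ _ mSC) => //.
- exact/measurable_realfun.measurable_EFinP.
- by apply/(@negligibleP _ _ _ mu _ mSC); exact: msupportC_negligible.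
rewrite setTD setCK; apply: measurable_bounded_integrable => //.
- exact: le_lt_trans (probability_le1 mu mS) (ltry 1).
- exact: measurable_funTS.
have /compact_bounded : compact (g @` msupport mu).
  by apply: continuous_compact => //; exact: continuous_subspaceT.
move=> [M [Mreal MP]]; exists M; split => // y My x Sx.
by apply: (MP y My); exists x.
Qed.

Lemma continuous_fct_sum (R : realType) (I : finType) (P : pred I)
    (g : I -> R -> R) :
  (forall i, P i -> continuous (g i)) ->
  continuous (fun x => \sum_(i | P i) g i x).
Proof.
move=> cg x; apply: (@cvg_big _ _ _ _ P _ _ _ _ g (g ^~ x)) => [|i Pi].
  exact: add_continuous.
exact: cg.
Qed.

Lemma Rintegral_fct_sum (R : realType) (d : measure_display)
    (T : measurableType d) (mu : {measure set T -> \bar R}) (I : Type)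
    (s : seq I) (P : pred I) (g : I -> T -> R) :
  (forall i, P i -> mu.-integrable setT (EFin \o g i)) ->
  \int[mu]_x (\sum_(i <- s | P i) g i x) = \sum_(i <- s | P i) \int[mu]_x g i x.
Proof.
move=> ig; elim: s => [|i s IHs].
  rewrite big_nil /Rintegral; under eq_integral do rewrite big_nil.
  by rewrite integral0.
rewrite big_cons; case: ifP => Pi; under eq_Rintegral do rewrite big_cons Pi.
  rewrite RintegralD ?IHs //; first exact: ig.
  under [X in integrable _ _ X]funext => x do rewrite /= -sumEFin.
  exact: integrable_sum.
exact: IHs.
Qed.

(** * Causal fixed points; continuity and causality of [Jhat] *)

Lemma causal_fixpoint (T : zmodType) (m n : nat)
    (F : 'M[T]_(m, n) -> 'M[T]_(m, n)) :
  (forall (A B : 'M[T]_(m, n)) (s : 'I_m),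
     (forall i : 'I_m, (i < s)%N -> forall j, A i j = B i j) ->
     forall j, F A s j = F B s j) ->
  exists! A, F A = A.
Proof.
move=> causal.
(* Each iteration of F fixes one more row for good. *)
have stable k (i : 'I_m) : (i < k)%N ->
    forall j, iter k F 0 i j = iter k.+1 F 0 i j.
  elim: k i => // k IHk i; rewrite ltnS => leik j.
  by apply: causal => l ltli; apply: IHk; exact: leq_trans leik.
(* All m rows are settled after m iterations, so the m-th iterate is fixed. For another fixed point
   B, agreement on the rows before i passes through F to row i. *)
exists (iter m F 0); split => [|B FB].
  by apply/matrixP => i j; rewrite -[LHS]/(iter m.+1 F 0 i j) -stable.
apply/matrixP => i; have [k] := ubnP i; elim: k i => // k IHk i.
rewrite ltnS => leik j; rewrite (stable m i (ltn_ord i)) -FB.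
by apply: causal => l ltli; apply: IHk; exact: leq_trans leik.
Qed.

(** The row recursion builds each entry from the f_k by sums and products, so continuity of matrix
    inversion is never invoked. *)
Lemma continuous_Jhat (R : realType) (f : nat -> R -> R) (t : nat)
    (Phi E : 'M[R]_t) (s j : 'I_t) :
  (forall k : nat, (0 < k)%N -> continuous (f k)) ->
  strictly_lower Phi -> is_trig_mx E ->
  continuous (fun x => Jhat f Phi E x s j).
Proof.
move=> cf lowPhi trigE.
have [m] := ubnP s; elim: m s => // m IHm s; rewrite ltnS => lesm.
have cU (k : 'I_t) : (k <= s)%N -> continuous (fun x => Uhat f Phi E x k j).
  move=> leks; under eq_fun do rewrite Uhat_entry //.
  move=> x; apply: cvgD; first exact: cvg_cst.
  apply: (@continuous_fct_sum R) => l ltlk y; apply: cvgM; first exact: cvg_cst.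
  exact: (IHm l (leq_trans (leq_trans ltlk leks) lesm)).
under eq_fun do rewrite Jhat_entry //.
move=> x; apply: cvgB; first by apply: cvgM; [exact: cf|exact: cU].
apply: (@continuous_fct_sum R) => k leks y; apply: cvgM; first exact: cvg_cst.
exact: cU.
Qed.

Lemma continuous_Uhat (R : realType) (f : nat -> R -> R) (t : nat)
    (Phi E : 'M[R]_t) (k j : 'I_t) :
  (forall k : nat, (0 < k)%N -> continuous (f k)) ->
  strictly_lower Phi -> is_trig_mx E ->
  continuous (fun x => Uhat f Phi E x k j).
Proof.
move=> cf lowPhi trigE; under eq_fun do rewrite Uhat_entry //.
move=> x; apply: cvgD; first exact: cvg_cst.
apply: (@continuous_fct_sum R) => l _ y; apply: cvgM; first exact: cvg_cst.
exact: continuous_Jhat.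
Qed.

(** Row s of J sees row s of E itself, while row s of U sees only earlier rows of J; this gap of one
    row makes [debias] causal. *)
Lemma Jhat_causal (R : realType) (f : nat -> R -> R) (t : nat)
    (Phi E E' : 'M[R]_t) (s : 'I_t) :
  strictly_lower Phi -> is_trig_mx E -> is_trig_mx E' ->
  (forall i : 'I_t, (i <= s)%N -> forall j, E i j = E' i j) ->
  forall x j, Jhat f Phi E x s j = Jhat f Phi E' x s j.
Proof.
move=> lowPhi trigE trigE' + x j.
have [m] := ubnP s; elim: m s => // m IHm s; rewrite ltnS => lesm eqE.
have eqU (k : 'I_t) : (k <= s)%N -> Uhat f Phi E x k j = Uhat f Phi E' x k j.
  move=> leks; rewrite !Uhat_entry //; congr (_ + _).
  apply: eq_bigr => l ltlk; have ltls := leq_trans ltlk leks.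
  rewrite (IHm l (leq_trans ltls lesm)) // => i leil.
  exact/eqE/(leq_trans leil)/ltnW.
rewrite !Jhat_entry // eqU //; congr (_ - _).
by apply: eq_bigr => k leks; rewrite eqU // eqE.
Qed.

(** * The zero-mean equation as a fixed-point problem *)

Definition lower_part (R : realType) (t : nat) (A : 'M[R]_t) : 'M[R]_t :=
  \matrix_(i, j) if (j <= i)%N then A i j else 0.

Lemma lower_part_trig (R : realType) (t : nat) (A : 'M[R]_t) :
  is_trig_mx (lower_part A).
Proof. by apply/is_trig_mxP => i j ltij; rewrite mxE leqNgt ltij. Qed.

Lemma lower_part_id (R : realType) (t : nat) (A : 'M[R]_t) :
  is_trig_mx A -> lower_part A = A.
Proof.
move=> /is_trig_mxP trigA; apply/matrixP => i j; rewrite mxE.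
by case: leqP => // ltij; rewrite trigA.
Qed.

(* lower_part E keeps Jden invertible on all matrices, so that debias is a total
   map to which causal_fixpoint applies. *)
Definition debias (R : realType) (mu : probability (measurableTypeR R) R)
    (f : nat -> R -> R) (t : nat) (Phi E : 'M[R]_t) : 'M[R]_t :=
  lower_part (\matrix_(s, j)
    \int[mu]_x (f s.+1 x * Uhat f Phi (lower_part E) x s j)).

Lemma debias_entry (R : realType) (mu : probability (measurableTypeR R) R)
    (f : nat -> R -> R) (t : nat) (Phi E : 'M[R]_t) (s j : 'I_t) :
  debias mu f Phi E s j =
    if (j <= s)%N then
      \int[mu]_x (f s.+1 x * Uhat f Phi (lower_part E) x s j)
    else 0.
Proof. by rewrite /debias [LHS]mxE [X in if _ then X else _]mxE. Qed.

Lemma debias_causal (R : realType) (mu : probability (measurableTypeR R) R)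
    (f : nat -> R -> R) (t : nat) (Phi A B : 'M[R]_t) (s : 'I_t) :
  strictly_lower Phi ->
  (forall i : 'I_t, (i < s)%N -> forall j, A i j = B i j) ->
  forall j, debias mu f Phi A s j = debias mu f Phi B s j.
Proof.
move=> lowPhi eqAB j; rewrite [LHS]debias_entry [RHS]debias_entry.
case: (leqP j s) => [_|_]; last by [].
apply: eq_Rintegral => x _; congr (_ * _); rewrite !Uhat_entry //.
congr (_ + _); apply: eq_bigr => l ltls; congr (_ * _).
apply: Jhat_causal => // [||i leil k]; try exact: lower_part_trig.
by rewrite !mxE eqAB // (leq_ltn_trans leil).
Qed.

(** Both directions rest on [meanJ], which needs zero means in the earlier rows: they are given in
    the forward direction and come from induction on s in the converse. *)
Lemma zero_mean_debias (R : realType)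
    (mu : probability (measurableTypeR R) R) (f : nat -> R -> R) (t : nat)
    (Phi E : 'M[R]_t) :
  compactly_supported mu ->
  (forall k : nat, (0 < k)%N -> continuous (f k)) ->
  strictly_lower Phi ->
  (is_trig_mx E /\ forall s j : 'I_t,
     'E_mu[fun x : measurableTypeR R => Jhat f Phi E x s j]%E = 0%E) <->
  debias mu f Phi E = E.
Proof.
move=> cptmu cf lowPhi.
pose mean (g : R -> R) : R := \int[mu]_(x in [set: measurableTypeR R]) g x.
have int g : continuous g ->
    mu.-integrable setT (EFin \o g : measurableTypeR R -> \bar R).
  exact: compactly_supported_integrable.
(* Either side forces E to be lower triangular, since every value of [debias] is. *)
wlog trigE : / is_trig_mx E.
  move=> H; split => [EP|debE]; first by apply/H => //; case: EP.
  by apply/H => //; rewrite -debE; exact: lower_part_trig.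
have cJ s j : continuous (fun x => Jhat f Phi E x s j).
  exact: continuous_Jhat.
have cU s j : continuous (fun x => Uhat f Phi E x s j).
  exact: continuous_Uhat.
have cfU (s j : 'I_t) : continuous (fun x => f s.+1 x * Uhat f Phi E x s j).
  by move=> x; apply: cvgM; [exact: cf|exact: cU].
have cZ (c : R) (g : R -> R) : continuous g -> continuous (fun x => c * g x).
  by move=> cg x; apply: cvgM; [exact: cvg_cst|exact: cg].
have mean_lin (c : R) (g : R -> R) :
    continuous g -> mean (fun x => c * g x) = c * mean g.
  by move=> cg; rewrite /mean RintegralZl //; exact: int.
(* The expectation is an extended real; integrability makes it finite, so it can be computed as a
   real integral. *)
have expE s j : 'E_mu[fun x : measurableTypeR R => Jhat f Phi E x s j]%E =
    (mean (fun x => Jhat f Phi E x s j))%:E.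
  by rewrite unlock /mean /Rintegral fineK // integrable_fin_num //; exact: int.
have meanU (k j : 'I_t) :
    (forall l : 'I_t, (l < k)%N -> mean (fun x => Jhat f Phi E x l j) = 0) ->
    mean (fun x => Uhat f Phi E x k j) = (k == j)%:R.
  move=> J0; rewrite /mean; under eq_Rintegral do rewrite Uhat_entry //.
  rewrite RintegralD //; first last.
  - by apply: int; apply: continuous_fct_sum => l _; exact: cZ.
  - by apply: int => x; exact: cvg_cst.
  rewrite Rintegral_cst //= probability_setT mulr1 Rintegral_fct_sum.
    rewrite big1 ?addr0 // => l ltlk.
    by apply: (etrans (mean_lin _ _ (cJ l j))); rewrite J0 // mulr0.
  by move=> l _; apply: int; exact: cZ.
have meanJ (s j : 'I_t) :
    (forall l : 'I_t, (l < s)%N -> mean (fun x => Jhat f Phi E x l j) = 0) ->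
    mean (fun x => Jhat f Phi E x s j) =
    mean (fun x => f s.+1 x * Uhat f Phi E x s j) - E s j.
  move=> J0; rewrite {1}/mean; under eq_Rintegral do rewrite Jhat_entry //.
  rewrite RintegralB //; first last.
  - by apply: int; apply: continuous_fct_sum => k _; exact: cZ.
  - exact: int.
  congr (_ - _); rewrite Rintegral_fct_sum; last first.
    by move=> k _; apply: int; exact: cZ.
  have -> : \sum_(k < t | (k <= s)%N)
      \int[mu]_x (E s k * Uhat f Phi E x k j) =
      \sum_(k < t | (k <= s)%N) E s k * (k == j)%:R.
    apply: eq_bigr => k leks; apply: (etrans (mean_lin _ _ (cU k j))).
    by rewrite meanU // => l ltlk; rewrite J0 // (leq_trans ltlk).
  (* For j <= s the Kronecker delta selects E_sj; for j > s no index k <= s equals j, and E_sj is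
     zero as well. *)
  case: (leqP j s) => [lejs|ltsj].
    rewrite (bigD1 j) //= eqxx mulr1 big1 ?addr0 // => k /andP[_ /negPf ->].
    by rewrite mulr0.
  rewrite (is_trig_mxP trigE) // big1 // => k leks.
  by rewrite -val_eqE /= (ltn_eqF (leq_ltn_trans leks ltsj)) mulr0.
have debE (s j : 'I_t) : (j <= s)%N ->
    debias mu f Phi E s j = mean (fun x => f s.+1 x * Uhat f Phi E x s j).
  by move=> lejs; rewrite debias_entry lejs lower_part_id.
split => [[_ zero]|fixE].
  have J0 s j : mean (fun x => Jhat f Phi E x s j) = 0.
    by apply: EFin_inj; rewrite -expE zero.
  apply/matrixP => s j; case: (leqP j s) => [lejs|ltsj]; last first.
    by rewrite !(is_trig_mxP _ _ _ ltsj) //; exact: lower_part_trig.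
  by rewrite debE //; apply/eqP; rewrite -subr_eq0 -meanJ // J0.
split=> // s j; rewrite expE; congr EFin.
have [m] := ubnP s; elim: m s => // m IHm s; rewrite ltnS => lesm.
case: (leqP j s) => [lejs|ltsj]; last first.
  (* Above the diagonal J vanishes identically; 0 is written as a multiple of a mean so that
     [mean_lin] turns it into an integral to compare with. *)
  rewrite -[RHS](mul0r (mean (cst 0))) -mean_lin; last exact: cst_continuous.
  apply: eq_Rintegral => x _; rewrite mul0r.
  by rewrite (is_trig_mxP (Jhat_trig _ _ lowPhi trigE)).
rewrite meanJ => [|l ltls]; last exact: IHm (leq_trans ltls lesm).
by rewrite -debE // fixE subrr.
Qed.

Theorem lemma4 (R : realType) (N : nat) (hN : (0 < N)%N)
    (W : 'M[R]_N) (hW : W^T = W)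
    (O : 'M[R]_N) (lam : 'rV[R]_N) (hO : eigendecomposition W O lam)
    (mu : probability (measurableTypeR R) R) (hmu : compactly_supported mu)
    (f : nat -> R -> R) (hf : forall t : nat, (0 < t)%N -> continuous (f t))
    (eta : forall j : nat, 'rV[R]_j.-1 -> R)
    (heta : forall j : nat, (1 < j)%N -> has_partials (eta j))
    (t : nat) (ht : (0 < t)%N) :
  (* (1) *)
  (forall (e : nat -> nat -> R) (r u : nat -> 'cV[R]_N) (E : 'M[R]_t),
     ri_amp_mp O lam f eta e r u ->
     is_trig_mx E ->
     (forall s i : 'I_t, (i <= s)%N -> E s i = e s.+1 i.+1) ->
     let J := Jhat f (Phihat eta r t) E in
     [/\ forall x : R, Jden f (Phihat eta r t) E x \in unitmx,
         forall x : R, is_trig_mx (J x)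
       & forall s : 'I_t,
           r s.+1 = \sum_(j < t | (j <= s)%N)
                      mxfun O lam (fun x => J x s j) *m ubar eta r u j.+1]) /\
  (* (2) *)
  (forall Phi : 'M[R]_t, strictly_lower Phi ->
     (forall (E : 'M[R]_t) (x : R), is_trig_mx E -> Jden f Phi E x \in unitmx) /\
     exists! E : 'M[R]_t,
       is_trig_mx E /\
       forall s j : 'I_t,
         'E_mu[fun x : measurableTypeR R => Jhat f Phi E x s j]%E = 0%E).
Proof.
have [OTO _ _] := hO; split => [e r u E amp trigE eE J|Phi lowPhi].
  have lowPhi : strictly_lower (Phihat eta r t).
    exact: Phihat_strictly_lower.
  split; [by move=> x; exact: Jden_unit|by move=> x; exact: Jhat_trig|].
  exact: (ri_amp_mp_rE OTO amp trigE eE).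
split=> [E x trigE|]; first exact: Jden_unit.
have [A B s eqAB|E [debE uniqE]] := @causal_fixpoint _ _ _ (debias mu f Phi).
  exact: debias_causal.
(* Solutions are exactly the fixed points of [debias], so unique existence transfers. *)
have zeroP E' := zero_mean_debias E' hmu hf lowPhi.
exists E; split => [|E' zeroE']; first exact/zeroP.
exact/uniqE/zeroP.
Qed.
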